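(* Let $f\in\mathcal F(\mathbb R^n)$, let $H$ be an $i$-dimensional linear subspace of $\mathbb R^n$, and let $\lambda\in[0,1]$. Then $$\int_{\mathbb R^n}f(z)\,dz\le\int_HP_Hf(x)^{1-\lambda}\,dx\;\sup_{x_0\in H}\int_{x_0+H^\perp}f(y)^\lambda\,dy .$$
   Context: $\mathcal F(\mathbb R^n)$ is the set of integrable log-concave functions $f:\mathbb R^n\to[0,\infty)$, i.e. $f((1-\lambda)x+\lambda y)\ge f(x)^{1-\lambda}f(y)^\lambda$ for all $x,y\in\mathbb R^n$, $\lambda\in[0,1]$. For a linear subspace $H$, $P_Hf(x)=\sup\{f(y):y\in x+H^\perp\}$ for $x\in H$. Integrals over (affine) subspaces are with respect to Lebesgue measure of the corresponding dimension, with values in $[0,\infty]$ and $0\cdot\infty=0$. *)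

(* Defs.v *)
From HB Require Import structures.
From mathcomp Require Import all_boot all_order all_algebra.
From mathcomp Require Import all_classical all_reals all_analysis.

Set Implicit Arguments.
Unset Strict Implicit.
Unset Printing Implicit Defensive.
Import Order.TTheory GRing.Theory Num.Theory.
Import numFieldNormedType.Exports.

Local Open Scope classical_set_scope.
Local Open Scope ring_scope.

Definition rV_display : measure_display.
Proof. exact: default_measure_display. Qed.

Section rV_measurable.
Variables (R : realType) (n : nat).

Let coord : 'I_n -> 'rV[R]_n -> measurableTypeR R := fun i v => v 0 i.

Let rV_set0 : g_sigma_preimage coord set0.
Proof. exact: sigma_algebra0. Qed.

Let rV_setC A : g_sigma_preimage coord A -> g_sigma_preimage coord (~` A).
Proof. exact: sigma_algebraC. Qed.

Let rV_bigcup (F : (set 'rV[R]_n)^nat) :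
  (forall i, g_sigma_preimage coord (F i)) ->
  g_sigma_preimage coord (\bigcup_i (F i)).
Proof. exact: sigma_algebra_bigcup. Qed.

(* The Borel sigma-algebra of R^n, generated by the coordinate functions. *)
HB.instance Definition _ := @isMeasurable.Build rV_display
  'rV[R]_n (g_sigma_preimage coord) rV_set0 rV_setC rV_bigcup.

End rV_measurable.

Lemma measurable_coord (R : realType) n (i : 'I_n) :
  measurable_fun [set: 'rV[R]_n] (fun v : 'rV[R]_n => v 0 i : measurableTypeR R).
Proof.
move=> _ Y mY; rewrite setTI; apply: sub_sigma_algebra => /=.
rewrite -bigcup_seq/=; exists i => /=; first by rewrite mem_index_enum.
by exists Y => //; rewrite setTI.
Qed.

Lemma measurable_fun_coordP (R : realType) d (T : measurableType d) n
    (f : T -> 'rV[R]_n) :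
  (forall i, measurable_fun setT (fun x => f x 0 i : measurableTypeR R)) ->
  measurable_fun setT f.
Proof.
move=> mf _ Y mY; rewrite setTI; move: Y mY.
apply: smallest_sub; last first.
  rewrite -bigcup_seq; apply: bigcup_sub => i _ A [B mB <-] /=.
  by rewrite setTI -[X in measurable X]setTI; exact: mf.
split => [|A /= mA|F mF] /=.
- by rewrite preimage_set0.
- by rewrite setTD preimage_setC; exact: measurableC.
- by rewrite preimage_bigcup; exact: bigcupT_measurable.
Qed.

Lemma sigma_finite_product d1 d2 (T1 : measurableType d1)
    (T2 : measurableType d2) (R : realType)
    (m1 : {sigma_finite_measure set T1 -> \bar R})
    (m2 : {sigma_finite_measure set T2 -> \bar R}) :
  sigma_finite setT (m1 \x m2)%E.
Proof.
have /sigma_finiteP[F [TF ndF Foo]] := sigma_finiteT m1.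
have /sigma_finiteP[G [TG ndG Goo]] := sigma_finiteT m2.
exists (fun n => F n `*` G n).
  rewrite -setXTT TF TG predeqE => -[x y]; split.
    move=> [/= [n _ Fnx] [k _ Gky]]; exists (maxn n k) => //; split.
    - by move: x Fnx; exact/subsetPset/ndF/leq_maxl.
    - by move: y Gky; exact/subsetPset/ndG/leq_maxr.
  by move=> [n _ []/= ? ?]; split; exists n.
move=> k; have [? ?] := Foo k; have [? ?] := Goo k.
split; first exact: measurableX.
by rewrite product_measure1E// lte_mul_pinfty// ge0_fin_numE.
Qed.

Section lebesgue_rV.
Variable R : realType.

Definition rV_cons n (p : measurableTypeR R * 'rV[R]_n) : 'rV[R]_n.+1 :=
  row_mx (p.1)%:M p.2.

Lemma measurable_rV_cons n : measurable_fun setT (@rV_cons n).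
Proof.
apply: measurable_fun_coordP => i; rewrite /rV_cons.
have [j ->|j ->] := split_ordP (i : 'I_(1 + n)).
  rewrite (_ : (fun _ => _) = fst) //; apply/funext => p.
  by apply: etrans (row_mxEl _ _ _ _) _; rewrite mxE !ord1 eqxx mulr1n.
rewrite (_ : (fun _ => _) = (fun v : 'rV[R]_n => v 0 j) \o snd).
  by apply: measurableT_comp => //; exact: measurable_coord.
by apply/funext => p; exact: row_mxEr.
Qed.

Definition rV_uncons n (v : 'rV[R]_n.+1) : measurableTypeR R * 'rV[R]_n :=
  (v 0 0, \row_j v 0 (lift 0 j)).

Lemma measurable_rV_uncons n : measurable_fun setT (@rV_uncons n).
Proof.
apply: measurable_fun_pair; first exact: measurable_coord.
apply: measurable_fun_coordP => i; under eq_fun do rewrite mxE.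
exact: measurable_coord.
Qed.

Lemma rV_consK n : cancel (@rV_cons n) (@rV_uncons n).
Proof.
move=> [x v]; congr pair => /=.
  have -> : 0 = lshift n (0 : 'I_1) :> 'I_(1 + n) by exact: val_inj.
  by apply: etrans (row_mxEl _ _ _ _) _; rewrite mxE eqxx mulr1n.
apply/rowP => j; rewrite mxE.
have -> : lift 0 j = rshift 1 j :> 'I_(1 + n) by exact: val_inj.
exact: row_mxEr.
Qed.

(* Lebesgue measure on the Borel sets of R^n: the n-fold product of the
   Lebesgue measure of the line, and the unit mass for n = 0. *)
Fixpoint borel_lebesgue n : set 'rV[R]_n -> \bar R :=
  if n is m.+1 then
    pushforward (@lebesgue_measure R \x @borel_lebesgue m)%E (@rV_cons m)
  else \d_(0 : 'rV[R]_0).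

Lemma borel_lebesgue_subproof n :
  {m : {sigma_finite_measure set 'rV[R]_n -> \bar R} |
    @borel_lebesgue n = m :> (set 'rV[R]_n -> \bar R)}.
Proof.
elim: n => [|n [m Em]] /=; first by exists \d_(0 : 'rV[R]_0).
rewrite Em.
pose pm : {measure set 'rV[R]_n.+1 -> \bar R} :=
  measure_function_pushforward__canonical__measure_function_Measure
    (@lebesgue_measure R \x m)%E (@measurable_rV_cons n).
have spm : sigma_finite setT pm.
  have [F TF Foo] := sigma_finite_product (@lebesgue_measure R) m.
  exists (fun k => @rV_uncons n @^-1` F k).
    by rewrite -preimage_bigcup -TF preimage_setT.
  move=> k; have [mF Fk] := Foo k; split.
    by rewrite -[X in measurable X]setTI; exact: measurable_rV_uncons.
  rewrite /pm /= /pushforward.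
  rewrite (_ : _ @^-1` _ = F k) //; apply/seteqP; split => p /=;
    by rewrite /= rV_consK.
pose H := Measure_isSigmaFinite.Build _ _ _ pm spm.
pose sm : {sigma_finite_measure set 'rV[R]_n.+1 -> \bar R} :=
  HB.pack_for {sigma_finite_measure set 'rV[R]_n.+1 -> \bar R} (Measure.sort pm) H.
by exists sm.
Qed.

Let borel_lebesgue0 n : borel_lebesgue (set0 : set 'rV[R]_n) = 0%E.
Proof. by have [m ->] := borel_lebesgue_subproof n; exact: measure0. Qed.

Let borel_lebesgue_ge0 n (A : set 'rV[R]_n) : (0 <= borel_lebesgue A)%E.
Proof. by have [m ->] := borel_lebesgue_subproof n; exact: measure_ge0. Qed.

Let borel_lebesgue_sigma_additive n :
  semi_sigma_additive (@borel_lebesgue n).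
Proof.
have [m ->] := borel_lebesgue_subproof n.
exact: measure_semi_sigma_additive.
Qed.

HB.instance Definition _ n := isMeasure.Build _ _ _ (@borel_lebesgue n)
  (@borel_lebesgue0 n) (@borel_lebesgue_ge0 n)
  (@borel_lebesgue_sigma_additive n).

Let borel_lebesgue_sigma_finite n : sigma_finite setT (@borel_lebesgue n).
Proof. by have [m ->] := borel_lebesgue_subproof n; exact: sigma_finiteT. Qed.

HB.instance Definition _ n := Measure_isSigmaFinite.Build _ _ _
  (@borel_lebesgue n) (@borel_lebesgue_sigma_finite n).

End lebesgue_rV.

(* Lebesgue measure on R^n: the completion of [borel_lebesgue], defined on the
   Lebesgue-measurable sets. *)
Definition lebesgue_rV (R : realType) (n : nat) :=
  @completed_measure_extension _ _ _ (@borel_lebesgue R n).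
Arguments lebesgue_rV : clear implicits.
HB.instance Definition _ R n := Measure.on (@lebesgue_rV R n).

Section euclidean.
Variables (R : realType) (n : nat).
Implicit Types (u v x : 'rV[R]_n) (V : {vspace 'rV[R]_n}).

Definition dot u v : R := \sum_(i < n) u 0 i * v 0 i.

Lemma dotE u v : dot u v = (u *m v^T) 0 0.
Proof. by rewrite mxE; apply: eq_bigr => i _; rewrite mxE. Qed.

Lemma dotC u v : dot u v = dot v u.
Proof. by apply: eq_bigr => i _; rewrite mulrC. Qed.

Lemma dotDl u v x : dot (u + v) x = dot u x + dot v x.
Proof. by rewrite !dotE mulmxDl mxE. Qed.

Lemma dotZl a u v : dot (a *: u) v = a * dot u v.
Proof. by rewrite !dotE -scalemxAl mxE. Qed.

Lemma dotNl u v : dot (- u) v = - dot u v.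
Proof. by rewrite -scaleN1r dotZl mulN1r. Qed.

Lemma dot_suml I (r : seq I) (P : pred I) (F : I -> 'rV[R]_n) v :
  dot (\sum_(i <- r | P i) F i) v = \sum_(i <- r | P i) dot (F i) v.
Proof.
rewrite dotE mulmx_suml summxE; apply: eq_bigr => i _; by rewrite dotE.
Qed.

Lemma dot_ge0 u : 0 <= dot u u.
Proof. by apply: sumr_ge0 => i _; rewrite -expr2 sqr_ge0. Qed.

Lemma dot_eq0 u : (dot u u == 0) = (u == 0).
Proof.
apply/eqP/eqP => [|->]; last by rewrite dotE mul0mx mxE.
move=> /psumr_eq0P u0; apply/rowP => i; rewrite mxE.
apply/eqP; rewrite -sqrf_eq0 expr2 u0 // => j _; by rewrite -expr2 sqr_ge0.
Qed.

Definition orth_compl V : {vspace 'rV[R]_n} :=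
  (\bigcap_(b <- vbasis V) lker (linfun (mulmxr b^T : 'rV[R]_n -> 'M[R]_1)))%VS.

Lemma orth_complP V v : v \in orth_compl V <-> forall u, u \in V -> dot v u = 0.
Proof.
have -> : v \in orth_compl V = all (fun b => dot v b == 0) (vbasis V).
  rewrite /orth_compl; elim: (tval (vbasis V)) => [|b s IH] /=.
    by rewrite big_nil memvf.
  rewrite big_cons memv_cap IH memv_ker lfunE /=; congr andb.
  rewrite dotE; apply/eqP/eqP => [->|]; first by rewrite mxE.
  by move=> h; apply/matrixP => i j; rewrite !ord1 h mxE.
split=> [/allP vb u uV|h].
  rewrite dotC (coord_vbasis uV) dot_suml big1 // => i _.
  rewrite dotZl dotC (eqP (vb _ _)) ?mulr0 //.
  by apply: mem_nth; rewrite size_tuple.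
by apply/allP => b bV; rewrite h // vbasis_mem.
Qed.

Definition orthonormal (e : seq 'rV[R]_n) :=
  forall i j : nat, (i < size e)%N -> (j < size e)%N ->
    dot e`_i e`_j = (i == j)%:R.

Lemma exists_orthonormal_basis V :
  exists e : (\dim V).-tuple 'rV[R]_n, basis_of V e /\ orthonormal e.
Proof.
suff H k : (k <= \dim V)%N -> exists e : seq 'rV[R]_n,
    [/\ size e = k, {subset e <= V} & orthonormal e].
  have [e [se eV oe]] := H _ (leqnn _).
  have se' : size e == \dim V by rewrite se.
  exists (Tuple se'); split => //.
  rewrite basisEfree /= se leqnn andbT; apply/andP; split.
    rewrite -[e]/(tval (in_tuple e)); apply/freeP => c c0 i.
    have := congr1 (dot ^~ e`_i) c0.
    rewrite dot_suml (bigD1 i) //= big1 ?addr0 => [|j ji].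
      by rewrite dotZl oe // eqxx mulr1 => ->; rewrite dotE mul0mx mxE.
    by rewrite dotZl oe // (_ : (j == i :> nat) = false) ?mulr0 //; exact: negbTE.
  by apply/span_subvP.
elim: k => [|k IH] kV; first by exists [::]; split.
have [e [se eV oe]] := IH (ltnW kV).
have /subvPn [v vV ve] : ~~ (V <= <<e>>)%VS.
  apply: contraL kV => /dimvS Ve; rewrite -leqNgt -se.
  exact: leq_trans Ve (dim_span _).
pose w := v - \sum_(i < size e) dot v e`_i *: e`_i.
have we i : (i < size e)%N -> dot w e`_i = 0.
  move=> ie; rewrite dotDl dotNl dot_suml (bigD1 (Ordinal ie)) //= big1.
    by rewrite dotZl oe // eqxx mulr1 addr0 subrr.
  move=> j ji; rewrite dotZl oe // (_ : (j == i :> nat) = false) ?mulr0 //.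
  by apply: contraNF ji => /eqP ji; apply/eqP/val_inj.
have w0 : dot w w != 0.
  rewrite dot_eq0 subr_eq0; apply: contraNneq ve => ->.
  by apply: memv_suml => i _; rewrite memvZ // memv_span // mem_nth.
have wV : w \in V.
  rewrite memvB //; apply: memv_suml => i _.
  by rewrite memvZ // eV // mem_nth.
pose w1 := (Num.sqrt (dot w w))^-1 *: w.
have ww1 : dot w1 w1 = 1.
  rewrite dotZl dotC dotZl mulrA -expr2 exprVn sqr_sqrtr ?dot_ge0 //.
  by rewrite mulVf.
have w1e i : (i < size e)%N -> dot w1 e`_i = 0.
  by move=> ie; rewrite dotZl we // mulr0.
exists (rcons e w1); split; first by rewrite size_rcons se.
- by move=> u; rewrite mem_rcons inE => /predU1P[->|/eV //]; rewrite memvZ.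
- move=> i j; rewrite size_rcons !ltnS !nth_rcons => ie je.
  have [ie'|ie'] := ltnP i (size e); have [je'|je'] := ltnP j (size e).
  + exact: oe.
  + have -> : j = size e by apply/eqP; rewrite eqn_leq je je'.
    by rewrite eqxx dotC w1e // (ltn_eqF ie').
  + have -> : i = size e by apply/eqP; rewrite eqn_leq ie ie'.
    by rewrite eqxx w1e // (gtn_eqF je').
  + have -> : j = size e by apply/eqP; rewrite eqn_leq je je'.
    have -> : i = size e by apply/eqP; rewrite eqn_leq ie ie'.
    by rewrite eqxx ww1.
Qed.

Definition orthonormal_basis V : (\dim V).-tuple 'rV[R]_n :=
  sval (cid (exists_orthonormal_basis V)).

(* Integral over the affine subspace x0 + V with respect to its
   (\dim V)-dimensional Lebesgue measure, obtained by transporting Lebesgue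
   measure of R^(\dim V) along an isometry onto x0 + V. The choice of the
   orthonormal basis is immaterial, by rotation invariance. *)
Definition affine_integral (x0 : 'rV[R]_n) V (g : 'rV[R]_n -> \bar R) : \bar R :=
  let e := orthonormal_basis V in
  (\int[lebesgue_rV R (\dim V)]_u
    g (x0 + \sum_(i < \dim V) (u : 'rV[R]_(\dim V)) 0 i *: e`_i)%R)%E.

(* The real powers [`^] of the library are used throughout: 0 `^ 0 = 1, and
   +oo `^ 0 = 1 on extended reals. *)
Definition log_concave (f : 'rV[R]_n -> R) :=
  forall x y (t : R), 0 <= t <= 1 ->
    f x `^ (1 - t) * f y `^ t <= f ((1 - t) *: x + t *: y).

Definition integrable_log_concave (f : 'rV[R]_n -> R) :=
  [/\ forall x, 0 <= f x, log_concave f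
    & (lebesgue_rV R n).-integrable setT (EFin \o f)].

(* Extended-real valued: [f] may be unbounded when its support lies in a
   proper affine subspace. *)
Definition projection_fun (V : {vspace 'rV[R]_n}) (f : 'rV[R]_n -> R) x : \bar R :=
  ereal_sup [set (f y)%:E | y in [set y | y - x \in orth_compl V]].

End euclidean.

(* Main.v *)
(* On the fibre over x in H one has f = f^(1-lambda) f^lambda <=
   (P_H f x)^(1-lambda) f^lambda, and the theorem is Fubini's theorem for
   R^n = H + H^perp. P_H f need not be Borel, nor need f be measurable on every
   fibre; so f is first replaced by a Borel function below it with the same
   integral, after which only monotonicity of lower integrals is used.
   The Fubini formula in rotated coordinates follows from uniqueness of
   translation-invariant measures: two such measures agreeing on one symmetric
   set of finite positive measure are equal. A cube identifies Lebesgue measure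
   on R^(p+q) with the product measure, and a ball gives the invariance under
   orthogonal matrices. *)
Require Import Defs.
From HB Require Import structures.
From mathcomp Require Import all_boot all_order all_algebra.
From mathcomp Require Import all_classical all_reals all_analysis.
From mathcomp Require Import measurable_realfun lra.
Import Order.TTheory GRing.Theory Num.Theory.
Import numFieldNormedType.Exports.
Local Open Scope classical_set_scope.
Local Open Scope ring_scope.

Set Implicit Arguments.
Unset Strict Implicit.
Unset Printing Implicit Defensive.

(** * Measure-preserving maps, pushforwards and product measures *)

Section measure_preserving.
Context d1 d2 (T1 : measurableType d1) (T2 : measurableType d2) (R : realType).

(** Preimages under [psi] carry over a sigma-finite cover of the source, with unchanged measures
    since [psi] cancels [phi]. The result is packed as a sigma-finite measure so that Tonelli
    applies to it later. *)
Lemma sigma_finite_pushforward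
    (m : {measure set T1 -> \bar R}) (phi : T1 -> T2) (psi : T2 -> T1) :
  sigma_finite setT m ->
  measurable_fun setT phi -> measurable_fun setT psi -> cancel phi psi ->
  {nu : {sigma_finite_measure set T2 -> \bar R} |
    nu = pushforward m phi :> (set T2 -> \bar R)}.
Proof.
move=> sfm mphi mpsi phiK.
pose pm : {measure set T2 -> \bar R} :=
  measure_function_pushforward__canonical__measure_function_Measure m mphi.
have spm : sigma_finite setT pm.
  have [F TF Foo] := sfm.
  exists (fun k => psi @^-1` F k).
    by rewrite -preimage_bigcup -TF preimage_setT.
  move=> k; have [mF Fk] := Foo k; split.
    by rewrite -[X in measurable X]setTI; exact: mpsi.
  rewrite /pm /= /pushforward.
  rewrite (_ : _ @^-1` _ = F k) //; apply/seteqP; split => p /=;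
    by rewrite /= phiK.
pose H := Measure_isSigmaFinite.Build _ _ _ pm spm.
by exists (HB.pack_for {sigma_finite_measure set T2 -> \bar R}
  (Measure.sort pm) H).
Qed.

Definition measure_preserving d (T : measurableType d)
    (m : set T -> \bar R) (phi : T -> T) :=
  measurable_fun setT phi /\
  forall A, measurable A -> m (phi @^-1` A) = m A.

(** The pushforward agrees with the product measure on measurable rectangles, which determine a
    product of sigma-finite measures. *)
Lemma measure_preserving_prod
    (m1 : {sigma_finite_measure set T1 -> \bar R})
    (m2 : {sigma_finite_measure set T2 -> \bar R}) phi1 phi2 :
  measure_preserving m1 phi1 -> measure_preserving m2 phi2 ->
  measure_preserving (m1 \x m2)%E (fun p => (phi1 p.1, phi2 p.2)).
Proof.
move=> [mphi1 inv1] [mphi2 inv2].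
have mphi : measurable_fun setT (fun p : T1 * T2 => (phi1 p.1, phi2 p.2)).
  by apply: measurable_fun_pair; apply: measurableT_comp.
split => // A mA.
pose pm : {measure set (T1 * T2) -> \bar R} :=
  measure_function_pushforward__canonical__measure_function_Measure
    (m1 \x m2)%E mphi.
rewrite [RHS](@product_measure_unique _ _ _ _ _ m1 m2 pm) // => A1 A2 mA1 mA2.
rewrite /pm /= /pushforward.
rewrite (_ : _ @^-1` _ = (phi1 @^-1` A1) `*` (phi2 @^-1` A2)) //.
have mA1' : measurable (phi1 @^-1` A1).
  by rewrite -[X in measurable X]setTI; exact: mphi1.
have mA2' : measurable (phi2 @^-1` A2).
  by rewrite -[X in measurable X]setTI; exact: mphi2.
rewrite product_measure1E //.
by congr (_ * _)%E; [exact: inv1|exact: inv2].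
Qed.

Lemma product_sections
    (m1 : {sigma_finite_measure set T1 -> \bar R})
    (m2 : {sigma_finite_measure set T2 -> \bar R}) (A : set (T1 * T2)) :
  measurable A ->
  (\int[m1]_x m2 (xsection A x) = \int[m2]_y m1 (ysection A y))%E.
Proof.
move=> mA; have := indic_fubini_tonelli m1 m2 mA.
by rewrite (indic_fubini_tonelli_FE _ mA) (indic_fubini_tonelli_GE _ mA).
Qed.

End measure_preserving.

(** Lebesgue measure is determined by its values on half-open intervals, and translation preserves
    their lengths. *)
Lemma lebesgue_measure_shift (R : realType) (a : R) :
  measure_preserving (@lebesgue_measure R)
    (fun x : measurableTypeR R => x + a : measurableTypeR R).
Proof.
have ma : measurable_fun setT (fun x : measurableTypeR R => x + a : measurableTypeR R).
  exact: measurable_funD.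
split=> // A mA; apply/esym.
pose pm : {measure set (measurableTypeR R) -> \bar R} :=
  measure_function_pushforward__canonical__measure_function_Measure
    (@lebesgue_measure R) ma.
apply: (@lebesgue_measure_unique _ pm) mA => _ [[b c]] _ <-.
rewrite /pm /= /pushforward.
rewrite (_ : _ @^-1` _ = `]b - a, c - a]%classic); last first.
  by apply/seteqP; split => x /=; rewrite !in_itv /= ltrBlDr lerBrDr.
by rewrite !lebesgue_measure_itv /= !lte_fin ltrD2r !EFinN -!EFinD opprB addrA subrK.
Qed.

(** * Translation-invariant measures on R^n and Borel measurability of vector operations *)

Definition translation_invariant (R : realType) n
    (mu : set 'rV[R]_n -> \bar R) :=
  forall a, measure_preserving mu (fun x => x + a).

Section rV_measurability.
Context (R : realType) (n : nat) d (T : measurableType d).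
Implicit Types f g : T -> 'rV[R]_n.

Lemma measurable_coord_comp f i :
  measurable_fun setT f -> measurable_fun setT (fun x => f x 0 i : measurableTypeR R).
Proof.
by move=> mf; apply: (measurableT_comp (measurable_coord (R:=R) i)).
Qed.

Lemma measurable_rVD f g : measurable_fun setT f -> measurable_fun setT g ->
  measurable_fun setT (fun x => f x + g x).
Proof.
move=> mf mg; apply: measurable_fun_coordP => i; under eq_fun do rewrite mxE.
by apply: (@measurable_funD _ T R); exact: measurable_coord_comp.
Qed.

Lemma measurable_rVN f : measurable_fun setT f ->
  measurable_fun setT (fun x => - f x).
Proof.
move=> mf; apply: measurable_fun_coordP => i; under eq_fun do rewrite mxE.
by apply: measurableT_comp => //; exact: measurable_coord_comp.
Qed.

Lemma measurable_rVM p f (Q : 'M[R]_(n, p)) : measurable_fun setT f ->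
  measurable_fun setT (fun x => f x *m Q).
Proof.
move=> mf; apply: measurable_fun_coordP => i; under eq_fun do rewrite mxE.
apply: (@measurable_sum _ T R _ _ _ (fun j x => f x 0 j * Q j i)) => j.
by apply: measurable_funM => //; exact: measurable_coord_comp.
Qed.

Lemma measurable_dot f g : measurable_fun setT f -> measurable_fun setT g ->
  measurable_fun setT (fun x => dot (f x) (g x) : measurableTypeR R).
Proof.
move=> mf mg; apply: (@measurable_sum _ T R _ _ _ (fun j x => f x 0 j * g x 0 j)) => j.
by apply: measurable_funM; exact: measurable_coord_comp.
Qed.

End rV_measurability.

Lemma measurable_row_mx (R : realType) p q :
  measurable_fun setT (fun z : 'rV[R]_p * 'rV[R]_q => row_mx z.1 z.2).
Proof.
apply: measurable_fun_coordP => i.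
have [j ->|j ->] := split_ordP i.
  by under eq_fun do rewrite row_mxEl; exact: measurable_coord_comp.
by under eq_fun do rewrite row_mxEr; exact: measurable_coord_comp.
Qed.

Lemma measurable_hsubmx (R : realType) p q :
  measurable_fun setT
    (fun v : 'rV[R]_(p + q) => (lsubmx v : 'rV_p, rsubmx v : 'rV_q)).
Proof.
apply: measurable_fun_pair; apply: measurable_fun_coordP => i;
  under eq_fun do rewrite mxE; exact: measurable_coord.
Qed.

(* Tonelli on [x + y \in A, y \in B] gives mu A * nu B = mu B * nu A. *)
Lemma translation_invariant_unique (R : realType) n
    (mu nu : {sigma_finite_measure set 'rV[R]_n -> \bar R}) (B : set 'rV[R]_n) :
  translation_invariant mu -> translation_invariant nu ->
  measurable B -> (forall x, B x -> B (- x)) ->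
  mu B = nu B -> (0 < mu B < +oo)%E ->
  forall A, measurable A -> mu A = nu A.
Proof.
move=> imu inu mB symB muB /andP[muB0 muBoo] A mA.
have Bopp : B = -%R @^-1` B.
  by apply/seteqP; split => x /= /symB //; rewrite opprK.
(* [S'] is the image of [S] under the shear adding the first coordinate to the second. Sections at a
   fixed first coordinate are thus translates of each other; those at a fixed second coordinate are
   empty or translates of [A], respectively of [-B]. *)
pose S := (fun p : 'rV[R]_n * 'rV[R]_n => p.1 + p.2) @^-1` A `&` snd @^-1` B.
pose S' := snd @^-1` A `&` (fun p : 'rV[R]_n * 'rV[R]_n => p.2 - p.1) @^-1` B.
have mS : measurable S.
  apply: measurableI; rewrite -[X in measurable X]setTI.
    exact: measurable_rVD mA.
  exact: measurable_snd.
have mS' : measurable S'.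
  apply: measurableI; rewrite -[X in measurable X]setTI.
    exact: measurable_snd.
  by apply: measurable_rVD mB => //; exact: measurable_rVN.
have E1 : (\int[nu]_y mu (ysection S y) = mu A * nu B)%E.
  rewrite (eq_integral (fun y => mu A * (\1_B y)%:E)%E); last first.
    move=> y _; rewrite indicE; case: (boolP (y \in B)) => yB.
      rewrite mule1 -((imu y).2 _ mA); congr (mu _).
      rewrite /ysection; apply/seteqP; split => x /=.
        by rewrite inE /S /= => -[].
      by move=> Axy; rewrite inE /S /=; split => //; rewrite inE in yB.
    rewrite mule0 (_ : ysection S y = set0) ?measure0 //.
    rewrite -subset0 /ysection => x /=; rewrite inE => -[_ /=].
    by move/mem_set; rewrite (negbTE yB).
  rewrite ge0_integralZl ?integral_indic ?setIT //.
  exact/measurable_EFinP/measurable_indic.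
(* The symmetry of [B] enters here, since the sections of [S'] are translates of [-B]. *)
have E2 : (\int[nu]_z mu (ysection S' z) = mu B * nu A)%E.
  rewrite (eq_integral (fun y => mu B * (\1_A y)%:E)%E); last first.
    move=> y _; rewrite indicE; case: (boolP (y \in A)) => yA.
      rewrite mule1 -((imu (- y)).2 _ mB); congr (mu _).
      rewrite /ysection; apply/seteqP; split => x /=.
        by rewrite inE /S' /= => -[] _ /symB; rewrite opprB.
      move=> Axy; rewrite inE /S' /=; split; first by rewrite inE in yA.
      by rewrite -opprB; exact: symB.
    rewrite mule0 (_ : ysection _ y = set0) ?measure0 //.
    rewrite -subset0 /ysection => x /=; rewrite inE => -[/= + _].
    by move/mem_set; rewrite (negbTE yA).
  rewrite ge0_integralZl ?integral_indic ?setIT //.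
  exact/measurable_EFinP/measurable_indic.
have : (mu A * nu B = mu B * nu A)%E.
  rewrite -E1 -E2 -!product_sections //; apply: eq_integral => x _.
  have mx : measurable (xsection S' x) by exact: measurable_xsection.
  rewrite -((inu x).2 _ mx); congr (nu _).
  rewrite /xsection; apply/seteqP; split => y /=; rewrite !inE /S /S' /=.
    by move=> [Axy By]; rewrite addrK (addrC y x).
  by rewrite addrK addrC.
have muBfin : mu B \is a fin_num by rewrite ge0_fin_numE.
rewrite -muB muleC => /(congr1 (fun x => ((fine (mu B))^-1)%:E * x)%E).
have E : (((fine (mu B))^-1)%:E * mu B = 1)%E.
  rewrite -[in X in (_ * X)%E](fineK muBfin) -EFinM mulVf //.
  by rewrite gt_eqF // fine_gt0 // muB0.
by rewrite !muleA E !mul1e.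
Qed.

(** * Boxes, balls and the symmetries of Lebesgue measure *)

Definition box (R : realType) n (r : R) : set 'rV[R]_n :=
  [set u | forall i, `|u 0 i| <= r].
Arguments box {R} n r.

(* The closed ball of radius [Num.sqrt r]. *)
Definition dball (R : realType) n (r : R) : set 'rV[R]_n :=
  [set u | dot u u <= r].
Arguments dball {R} n r.

Section borel_lebesgue_theory.
Context (R : realType).
Notation bl n := (@borel_lebesgue R n).

(** A translation of the target lifts through [phi] to a measure-preserving map [tau] of the
    source. *)
Lemma translation_invariant_pushforward d (T : measurableType d) n
    (m : set T -> \bar R) (phi : T -> 'rV[R]_n) :
  measurable_fun setT phi ->
  (forall a, exists tau, measure_preserving m tau /\
    forall z, phi (tau z) = phi z + a) ->
  translation_invariant (pushforward m phi).
Proof.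
move=> mphi mtau a; split; first exact: measurable_rVD.
move=> A mA; have [tau [[_ inv] phitau]] := mtau a.
rewrite /pushforward -[RHS]inv; last by rewrite -[X in measurable X]setTI; exact: mphi.
by congr m; apply/seteqP; split => z /=; rewrite phitau.
Qed.

Lemma borel_lebesgueS n : bl n.+1 =
  pushforward (@lebesgue_measure R \x bl n)%E (@rV_cons R n).
Proof. by []. Qed.

Lemma rV_cons0 n (p : measurableTypeR R * 'rV[R]_n) : rV_cons p 0 0 = p.1.
Proof. by move: (congr1 fst (@rV_consK R n p)) => /= h; exact h. Qed.

Lemma rV_cons_lift n (p : measurableTypeR R * 'rV[R]_n) (j : 'I_n) :
  rV_cons p 0 (lift 0 j) = p.2 0 j.
Proof. by have := congr1 (fun z : measurableTypeR R * 'rV[R]_n => z.2 0 j) (@rV_consK R n p); rewrite mxE. Qed.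

Lemma rV_consD n (p q : measurableTypeR R * 'rV[R]_n) :
  rV_cons (p.1 + q.1, p.2 + q.2) = rV_cons p + rV_cons q.
Proof.
apply/rowP => i; rewrite [RHS]mxE; have [j ->|->] := unliftP 0 i.
  by rewrite !rV_cons_lift mxE.
by rewrite !rV_cons0.
Qed.

Lemma rV_unconsK n : cancel (@rV_uncons R n) (@rV_cons R n).
Proof.
move=> v; apply/rowP => i; have [j ->|->] := unliftP 0 i.
  by rewrite rV_cons_lift mxE.
by rewrite rV_cons0.
Qed.

(** Induction on the dimension: through [rV_cons] a translation splits into one of the line and one
    of the remaining coordinates. *)
Lemma borel_lebesgue_translation n : translation_invariant (bl n).
Proof.
elim: n => [|n IH] a.
  split; first exact: measurable_rVD.
  move=> A mA; congr (bl 0 _).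
  by apply/seteqP; split => x /=; rewrite (thinmx0 a) addr0.
rewrite borel_lebesgueS; apply: translation_invariant_pushforward.
  exact: measurable_rV_cons.
move=> {}a; exists (fun p => (p.1 + (rV_uncons a).1, p.2 + (rV_uncons a).2)).
split; last by move=> z; rewrite rV_consD rV_unconsK.
apply: (measure_preserving_prod (m1 := @lebesgue_measure R) (m2 := bl n)
  (phi1 := fun x : measurableTypeR R => x + (rV_uncons a).1 : measurableTypeR R)
  (phi2 := fun x => x + (rV_uncons a).2)).
  exact: lebesgue_measure_shift.
exact: IH.
Qed.

Lemma measurable_box n (r : R) : measurable (box n r).
Proof.
pose F (i : 'I_n) := (fun u : 'rV[R]_n => u 0 i : measurableTypeR R) @^-1` `[- r, r].
rewrite (_ : box n r = \bigcap_(i in [set: 'I_n]) F i).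
  apply: fin_bigcap_measurable => // i _.
  by rewrite -[X in measurable X]setTI; exact: measurable_coord.
by apply/seteqP; split => u h i; have := h i; rewrite /F /= in_itv /= ler_norml //; exact.
Qed.

Lemma borel_lebesgue_box n (r : R) : 0 <= r -> bl n (box n r) = ((r *+ 2) ^+ n)%:E.
Proof.
move=> r0; elim: n => [|n IH].
  rewrite expr0 /= diracE (_ : _ \in _) //.
  by rewrite inE => -[].
rewrite borel_lebesgueS /pushforward.
rewrite (_ : _ @^-1` _ = `[- r, r]%classic `*` box n r); last first.
  apply/seteqP; split => -[x v] /=.
    move=> h; split; first by rewrite in_itv /= -ler_norml; have := h 0; rewrite rV_cons0.
    by move=> i; have := h (lift 0 i); rewrite rV_cons_lift.
  rewrite in_itv /= -ler_norml => -[xr vr] i.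
  by have [j ->|->] := unliftP 0 i; rewrite ?rV_cons_lift ?rV_cons0.
rewrite product_measure1E //; last exact: measurable_box.
have -> : ((r *+ 2) ^+ n.+1)%:E = ((r *+ 2)%:E * ((r *+ 2) ^+ n)%:E)%E by rewrite exprS.
congr (_ * _)%E; last exact: IH.
suff h : lebesgue_measure (`[- r, r]%classic : set R) = (r *+ 2)%:E by exact: h.
rewrite lebesgue_measure_itv /= lte_fin.
case: ltP => [_|]; first by rewrite opprK mulr2n.
by move=> rr; congr EFin; lra.
Qed.

(** [borel_lebesgue] splits off one coordinate at a time. To split at [p], it is compared with the
    pushforward of the product, also translation invariant, on the cube of side 2. *)
Lemma borel_lebesgue_row_mx p q (A : set 'rV[R]_(p + q)) : measurable A ->
  bl (p + q) A = (bl p \x bl q)%E ((fun z => row_mx z.1 z.2) @^-1` A).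
Proof.
have [nu nuE] := sigma_finite_pushforward (sigma_finite_product (bl p) (bl q))
  (measurable_row_mx (R:=R) (p:=p) (q:=q)) (measurable_hsubmx (R:=R) (p:=p) (q:=q))
  (fun z => match z with (u, v) => congr2 pair (row_mxKl u v) (row_mxKr u v) end).
suff blnu : measurable A -> bl (p + q) A = nu A.
  by move=> mA; rewrite blnu // nuE.
have bb : bl (p + q) (box (p + q) 1) = nu (box (p + q) 1).
  rewrite nuE /pushforward (_ : _ @^-1` _ = box p 1 `*` box q 1); last first.
    apply/seteqP; split => -[u v] /=.
      move=> h; split => i; first by have := h (lshift q i); rewrite row_mxEl.
      by have := h (rshift p i); rewrite row_mxEr.
    move=> [hu hv] i; have [j ->|j ->] := split_ordP i.
      by rewrite row_mxEl.
    by rewrite row_mxEr.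
  rewrite [RHS](product_measure1E (bl p) (bl q)); [|exact: measurable_box|exact: measurable_box].
  rewrite borel_lebesgue_box // exprD EFinM.
  by congr (_ * _)%E; apply/esym/borel_lebesgue_box.
apply: (@translation_invariant_unique R (p + q) (bl (p + q)) nu (box (p + q) 1) _ _ _ _ bb _ A).
- exact: borel_lebesgue_translation.
- rewrite nuE; apply: translation_invariant_pushforward.
    exact: measurable_row_mx.
  move=> a; exists (fun z => (z.1 + lsubmx a, z.2 + rsubmx a)); split; last first.
    by move=> z /=; rewrite -add_row_mx hsubmxK.
  by apply: (measure_preserving_prod (m1 := bl p) (m2 := bl q)
    (phi1 := fun x => x + lsubmx a) (phi2 := fun x => x + rsubmx a));
    exact: borel_lebesgue_translation.
- exact: measurable_box.
- by move=> x h i; rewrite mxE normrN.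
- suff : (0 < bl (p + q) (box (p + q) 1) < +oo)%E by exact.
  by rewrite borel_lebesgue_box // lte_fin exprn_gt0 //= ltry.
Qed.

Lemma measurable_dball n (r : R) : measurable (dball n r).
Proof.
rewrite (_ : dball n r =
  setT `&` (fun u : 'rV[R]_n => dot u u : measurableTypeR R) @^-1` `]-oo, r]).
  exact: measurable_dot.
by rewrite setTI; apply/seteqP; split => u /=; rewrite in_itv.
Qed.

(** The radius is the square root of [r], which is at most [r] once [1 <= r]. *)
Lemma dball_sub_box n (r : R) : 1 <= r -> dball n r `<=` box n r.
Proof.
move=> r1 u /= ur i.
have ui : (u 0 i) ^+ 2 <= r.
  apply: le_trans ur; rewrite /dot (bigD1 i) //= -expr2 lerDl.
  by apply: sumr_ge0 => j _; rewrite -expr2 sqr_ge0.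
rewrite -(@ler_pXn2r _ 2) ?nnegrE ?(le_trans ler01 r1) //.
by rewrite real_normK ?num_real // (le_trans ui) // expr2 ler_peMl // (le_trans ler01 r1).
Qed.

(** The sum of [n] squares, each at most 1/(n+1), is below 1; the successor keeps the half-side
    positive when [n = 0]. *)
Lemma box_sub_dball n : box n (n.+1%:R^-1 : R) `<=` dball n (1 : R).
Proof.
move=> u /= ur; rewrite /dot.
apply: (@le_trans _ _ (\sum_(i < n) n.+1%:R^-1)).
  apply: ler_sum => i _; rewrite -expr2 -real_normK ?num_real // expr2.
  rewrite (le_trans (ler_piMl _ _)) ?ur // (le_trans (ur i)) // invf_le1 ?ltr0n //.
  by rewrite ler1n.
rewrite sumr_const card_ord -[X in X <= _]mulr_natl ler_pdivrMr ?ltr0n // mul1r ler_nat.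
exact: leqnSn.
Qed.

Lemma borel_lebesgue_dball n : (0 < bl n (dball n 1) < +oo)%E.
Proof.
apply/andP; split.
  apply: (@lt_le_trans _ _ (bl n (box n (n.+1%:R^-1 : R)))).
    by rewrite borel_lebesgue_box // lte_fin exprn_gt0 // pmulrn_lgt0 // invr_gt0 ltr0n.
  by apply: le_measure; rewrite ?inE; [exact: measurable_box|exact: measurable_dball|exact: box_sub_dball].
apply: (@le_lt_trans _ _ (bl n (box n 1))).
  by apply: le_measure; rewrite ?inE; [exact: measurable_dball|exact: measurable_box|exact: dball_sub_box].
by rewrite borel_lebesgue_box // ltry.
Qed.

(** The unit ball is the test set because [Q] preserves [dot]. The equality [m = n] is a hypothesis
    since in the application [m] is a sum of two dimensions, equal to [n] only propositionally. *)
Lemma borel_lebesgue_orthogonal m n (Q : 'M[R]_(m, n)) (A : set 'rV[R]_n) :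
  m = n -> Q *m Q^T = 1%:M -> measurable A ->
  bl n A = bl m ((fun u => u *m Q) @^-1` A).
Proof.
move=> mn QQ; subst m.
 have QQ' : Q^T *m Q = 1%:M by exact: mulmx1C.
have mQ (P : 'M[R]_n) : measurable_fun setT (fun u : 'rV[R]_n => u *m P).
  exact: measurable_rVM.
have QK : cancel (fun u : 'rV[R]_n => u *m Q) (fun u => u *m Q^T).
  by move=> u; rewrite -mulmxA QQ mulmx1.
have [nu nuE] := sigma_finite_pushforward (sigma_finiteT (bl n)) (mQ Q) (mQ Q^T) QK.
suff blnu : measurable A -> bl n A = nu A.
  by move=> mA; rewrite blnu // nuE.
have bb : bl n (dball n 1) = nu (dball n 1).
  rewrite nuE /pushforward; congr (bl n _); apply/seteqP; split => u /=;
  by rewrite /dball /= !dotE trmx_mul mulmxA -(mulmxA u) QQ mulmx1.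
apply: (@translation_invariant_unique R n (bl n) nu (dball n 1) _ _ _ _ bb _ A).
- exact: borel_lebesgue_translation.
- rewrite nuE; apply: translation_invariant_pushforward => // a.
  exists (fun u => u + a *m Q^T); split; last first.
    by move=> u; rewrite mulmxDl -mulmxA QQ' mulmx1.
  exact: borel_lebesgue_translation.
- exact: measurable_dball.
- by move=> u; rewrite /dball /= -scaleN1r dotZl dotC dotZl mulrA mulrNN !mul1r.
- exact: borel_lebesgue_dball.
Qed.

(** Transport along the orthogonal matrix with blocks [E] and [E'], split the coordinates into two
    blocks, and apply Tonelli. *)
Lemma tonelli_orthogonal p q n (E : 'M[R]_(p, n)) (E' : 'M[R]_(q, n))
    (h : 'rV[R]_n -> \bar R) :
  (p + q)%N = n -> col_mx E E' *m (col_mx E E')^T = 1%:M ->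
  measurable_fun setT h -> (forall x, 0 <= h x)%E ->
  (\int[bl n]_z h z = \int[bl p]_u \int[bl q]_v h (u *m E + v *m E')%R)%E.
Proof.
move=> pqn EE mh h0.
pose phi (z : 'rV[R]_p * 'rV[R]_q) := z.1 *m E + z.2 *m E'.
have mphi : measurable_fun setT phi by apply: measurable_rVD; exact: measurable_rVM.
pose pm : {measure set 'rV[R]_n -> \bar R} :=
  measure_function_pushforward__canonical__measure_function_Measure
    (bl p \x bl q)%E mphi.
rewrite (eq_measure_integral pm) => [|A mA _]; last first.
  apply: etrans (borel_lebesgue_orthogonal pqn EE mA) _.
  rewrite borel_lebesgue_row_mx; last first.
    by rewrite -[X in measurable X]setTI; exact: measurable_rVM.
  rewrite /pm /= /pushforward; congr (_ _).
  by apply/seteqP; split => z; rewrite /= mul_row_col.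
rewrite ge0_integral_pushforward // preimage_setT.
rewrite (@fubini_tonelli1 _ _ _ _ _ (bl p) (bl q)) //.
  exact: measurableT_comp.
by move=> z; exact: h0.
Qed.

End borel_lebesgue_theory.

(** * Completion of a sigma-finite measure, and lower integrals *)

Section completed_measure.
Context d (T : measurableType d) (R : realType).
Variable mu : {sigma_finite_measure set T -> \bar R}.
Notation cmu := (@completed_measure_extension d T R mu).
Notation cT := (caratheodory_type (mu^*)%mu).

Lemma completedE (A : set T) : measurable A -> cmu A = mu A.
Proof. exact: measurable_mu_extE. Qed.

Lemma measurable_completed (A : set T) :
  measurable A -> measurable (A : set cT).
Proof. exact: caratheodory_measurable_mu_ext. Qed.

(** On arbitrary sets [cmu] is the outer measure of [mu]. Countable covers of [X] optimal up to
    1/(k+1) have measurable unions, whose intersection attains the infimum. *)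
Lemma measurable_cover_exists (X : set T) :
  exists G, [/\ measurable G, X `<=` G & mu G = cmu X].
Proof.
have [Xoo|Xoo] := eqVneq (cmu X) +oo%E.
  exists setT; split => //; rewrite Xoo; apply/eqP.
  rewrite -leye_eq -Xoo -(completedE measurableT).
  exact: le_mu_ext.
have Xfin : cmu X \is a fin_num.
  by rewrite ge0_fin_numE ?lt_neqAle ?Xoo ?leey //; exact: mu_ext_ge0.
have H k : exists G, [/\ measurable G, X `<=` G & (mu G <= cmu X + k.+1%:R^-1%:E)%E].
  have : (cmu X < cmu X + k.+1%:R^-1%:E)%E by rewrite lteDl // lte_fin invr_gt0 ltr0n.
  move=> /ereal_inf_lt [_ [F [mF XF] <-]] /ltW Flt.
  exists (\bigcup_i F i); split => //; first exact: bigcupT_measurable.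
  apply: le_trans Flt; apply: measure_sigma_subadditive => //.
  exact: bigcupT_measurable.
have [G HG] := choice H.
have mG : measurable (\bigcap_k G k).
  by apply: bigcapT_measurable => k; have [] := HG k.
have XG : X `<=` \bigcap_k G k.
  by move=> x Xx k _; have [_ XGk _] := HG k; exact: XGk.
exists (\bigcap_k G k); split => //; apply/eqP; rewrite eq_le; apply/andP; split.
  apply/lee_addgt0Pr => e e0.
  have [k ke] : exists k, k.+1%:R^-1 < e by have [k] := ltr_add_invr e0; rewrite add0r => ?; exists k.
  have [mGk _ Gk] := HG k.
  apply: (@le_trans _ _ (mu (G k))).
    by apply: le_measure; rewrite ?inE // => x; exact.
  by apply: (le_trans Gk); rewrite leeD2l // lee_fin ltW.
by rewrite -(completedE mG); exact: le_mu_ext.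
Qed.

(** From each piece [F k] of finite measure, remove a measurable cover [N] of the part outside [A]:
    the rest lies in [A] and misses only a null part of it. The union over [k] then misses only a
    null part of [A]. *)
Lemma completed_kernel_exists (A : set cT) : measurable A ->
  exists B : set T, [/\ measurable B, B `<=` A & mu B = cmu A].
Proof.
move=> mA; have [F TF Foo] := sigma_finiteT mu.
have H k : exists B : set T, [/\ measurable B, B `<=` A & cmu ((A `&` F k) `\` B) = 0%E].
  have [mF Fk] := Foo k.
  have mcF := measurable_completed mF.
  have [N [mN FN muN]] := measurable_cover_exists (F k `\` A).
  have BA : F k `\` N `<=` A `&` F k.
    by move=> x [Fx Nx]; split => //; apply: contrapT => Ax; apply: Nx; exact: FN.
  have mB := measurableD mF mN.
  have mcB := measurable_completed mB.
  have mAF : measurable (A `&` F k : set cT) by exact: measurableI.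
  exists (F k `\` N); split => //; first by move=> x /BA [].
  have NF : (F k `\` A : set cT) `<=` N `&` F k by move=> x h; split; [exact: FN|case: h].
  (* [N] may leave [F k], but its trace on [F k] still covers the part outside [A]. *)
  have muNF : mu (N `&` F k) = cmu (F k `\` A).
    apply/eqP; rewrite eq_le; apply/andP; split.
      by rewrite -muN; apply: le_measure; rewrite ?inE //; exact: measurableI.
    by rewrite -completedE; [exact: le_mu_ext|exact: measurableI].
  have finF : (cmu (F k : set cT) < +oo)%E by rewrite completedE.
  have finB : (cmu (A `&` F k : set cT) < +oo)%E.
    by apply: le_lt_trans finF; apply: le_mu_ext.
  have e1 : cmu ((A `&` F k) `\` (F k `\` N)) = (cmu (A `&` F k) - cmu (F k `\` N))%E.
    rewrite -[in X in (_ - X)%E](setIidr BA).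
    exact: (@measureD _ cT _ cmu (A `&` F k) (F k `\` N)).
  have e2 : cmu (F k `\` A) = (cmu (F k) - cmu (A `&` F k))%E.
    by rewrite setIC; exact: (@measureD _ cT _ cmu (F k) A).
  have e3 : mu (F k `\` N) = (mu (F k) - cmu (F k `\` A))%E.
    by rewrite -muNF setIC; exact: measureD.
  (* All terms are finite, and the measure reduces to a - (m - (m - a)) = 0 with m the measure of
     [F k]. *)
  rewrite e1 (completedE mB) e3 e2 (completedE mF).
  set a := cmu (A `&` F k); have a_fin : a \is a fin_num.
    by rewrite ge0_fin_numE //; exact: mu_ext_ge0.
  have F_fin : mu (F k) \is a fin_num by rewrite ge0_fin_numE.
  by rewrite -(fineK a_fin) -(fineK F_fin) -!EFinB; congr EFin; lra.
have [B HB] := choice H.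
have mB : measurable (\bigcup_k B k) by apply: bigcupT_measurable => k; have [] := HB k.
have mcB := measurable_completed mB.
have BA : \bigcup_k B k `<=` A by move=> x [k _ Bx]; have [_ + _] := HB k; exact.
exists (\bigcup_k B k); split => //; rewrite -(completedE mB).
have N0 : cmu (A `\` \bigcup_k B k) = 0%E.
  apply/eqP; rewrite eq_le; apply/andP; split; last exact: mu_ext_ge0.
  apply: (@le_trans _ _ (cmu (\bigcup_k ((A `&` F k) `\` B k)))).
    apply: le_mu_ext => x [Ax Bx].
    have [k _ Fx] : (\bigcup_k F k) x by rewrite -TF.
    by exists k => //; split => // Bk; apply: Bx; exists k.
  apply: le_trans (mu_ext_sigma_subadditive (measure_ge0 mu) _) _.
  by rewrite eseries0 // => k _ _; have [] := HB k.
apply/eqP; rewrite eq_le; apply/andP; split; first exact: le_mu_ext.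
have -> : cmu A = cmu ((\bigcup_k B k) `|` (A `\` \bigcup_k B k)) by rewrite setDUK.
apply: le_trans (outer_measureU2 _ _ _) _.
by rewrite [X in (_ + X)%E]N0 adde0.
Qed.

(** The identity is measurable from the completed sigma-algebra to the original one and pushes [cmu]
    forward to [mu]. *)
Lemma integral_completed (h : T -> \bar R) :
  measurable_fun setT h -> (forall x, 0 <= h x)%E ->
  (\int[cmu]_x h x = \int[mu]_x h x)%E.
Proof.
move=> mh h0.
have mid : measurable_fun [set: cT] (id : cT -> T).
  by move=> _ Y mY; rewrite setTI; exact: measurable_completed.
pose pm : {measure set T -> \bar R} :=
  measure_function_pushforward__canonical__measure_function_Measure cmu mid.
rewrite (eq_measure_integral pm) => [|A mA _]; last exact: esym (completedE mA).
by rewrite ge0_integral_pushforward.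
Qed.

Import HBNNSimple.

(* [f] need not be measurable: the library integral of a nonnegative function
   is a supremum over the simple functions below it. *)
Lemma le_completed_integral (f : T -> \bar R) (c : \bar R) :
  (forall x, 0 <= f x)%E ->
  (forall h : T -> R, measurable_fun setT h -> (forall x, 0 <= h x) ->
    (exists M, forall x, h x <= M) -> (forall x, (h x)%:E <= f x)%E ->
    (\int[mu]_x (h x)%:E <= c)%E) ->
  (\int[cmu]_x f x <= c)%E.
Proof.
move=> f0 fc; rewrite ge0_integralTE //; apply: ge_ereal_sup => _ [s /= sf <-].
have ms r : measurable (s @^-1` [set r] : set cT) by exact: measurable_sfunP.
(* Each level set of [s] is shrunk to a kernel [B r] in the original sigma-algebra with the same
   measure; off the kernels [h] below is 0. *)
have [B HB] := choice (fun r => completed_kernel_exists (ms r)).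
have mB r : measurable (B r) by have [] := HB r.
have Bs r : B r `<=` s @^-1` [set r] by have [] := HB r.
have muB r : mu (B r) = cmu (s @^-1` [set r]) by have [] := HB r.
pose I := finmap.enum_fset (fset_set (range s)).
have rB r x : 0 <= r * \1_(B r) x.
  rewrite indicE; case: (boolP (x \in B r)) => [|_]; last by rewrite mulr0.
  by rewrite inE mulr1 => /Bs <-.
have sE x : s x = \sum_(r <- I) r * \1_(s @^-1` [set r]) x.
  by rewrite fimfunE fsbig_finite.
pose h x := \sum_(r <- I) r * \1_(B r) x.
have mrB r : measurable_fun setT (fun x => r * \1_(B r) x).
  by apply: measurable_funM => //; exact: measurable_indic.
have -> : sintegral cmu s = (\int[mu]_x (h x)%:E)%E.
  rewrite sintegralE fsbig_finite //=.
  rewrite (eq_integral (fun x => \sum_(r <- I) (r * \1_(B r) x)%:E)%E); last first.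
    by move=> x _; rewrite /h -sumEFin.
  rewrite ge0_integral_sum //; last 2 first.
    by move=> r; apply/measurable_EFinP.
    by move=> r x _; rewrite lee_fin.
  rewrite /I; apply: eq_bigr => r _; rewrite -muB.
  have [r0|r0] := leP 0 r.
    under eq_integral do rewrite EFinM.
    rewrite ge0_integralZl ?lee_fin //; last exact/measurable_EFinP/measurable_indic.
    by rewrite integral_indic // setIT.
  (* [s] is nonnegative, so its level set at a negative [r] is empty. *)
  have -> : B r = set0.
    by rewrite -subset0 => x /Bs /= sxr; move: r0; rewrite -sxr ltNge fun_ge0.
  rewrite measure0 mule0 integral0_eq // => x _.
  by rewrite indicE in_set0 mulr0.
have hs x : h x <= s x.
  rewrite sE; apply: ler_sum => r _; rewrite [leRHS]mulrC.
  rewrite !indicE; case: (boolP (x \in B r)) => xB.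
    by rewrite mulr1 mem_set ?mul1r //; apply: Bs; rewrite inE in xB.
  rewrite mulr0; case: (boolP (x \in _)) => [|_]; last by rewrite mul0r.
  by rewrite inE mul1r => <-.
apply: fc => [|x|| x].
- exact: measurable_sum.
- by apply: sumr_ge0.
- exists (\sum_(r <- I) `|r|) => x; apply: ler_sum => r _.
  rewrite indicE; case: (_ \in _); first by rewrite mulr1 ler_norm.
  by rewrite mulr0.
- by apply: le_trans (sf x); rewrite lee_fin.
Qed.

End completed_measure.

Section lower_integral.
Context d (T : measurableType d) (R : realType) (mu : {measure set T -> \bar R}).

Import HBNNSimple.

(** Simple functions below [f] are also below [g], so the supremum for [f] is the smaller one,
    measurable or not. *)
Lemma le_integral_lower (f g : T -> \bar R) :
  (forall x, 0 <= f x)%E -> (forall x, f x <= g x)%E ->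
  (\int[mu]_x f x <= \int[mu]_x g x)%E.
Proof.
move=> f0 fg; rewrite !ge0_integralTE //; last by move=> x; exact: le_trans (fg x).
apply: le_ereal_sup => _ [s sf <-]; exists s => // x.
exact: le_trans (fg x).
Qed.

End lower_integral.

(** * Orthonormal coordinates adapted to a subspace and its orthogonal complement *)

Section basis_matrix.
Context (R : realType) (n : nat).
Implicit Types V : {vspace 'rV[R]_n}.

(** The rows are the basis used by [affine_integral], so [u *m basis_mx V] is the point of [V] with
    coordinates [u]. *)
Definition basis_mx V : 'M[R]_(\dim V, n) :=
  \matrix_(j < \dim V) (orthonormal_basis V)`_j.

Lemma orthonormal_basisP V :
  basis_of V (orthonormal_basis V) /\ Defs.orthonormal (orthonormal_basis V).
Proof. by rewrite /orthonormal_basis; case: cid. Qed.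

Lemma mul_basis_mx V (u : 'rV[R]_(\dim V)) :
  u *m basis_mx V = \sum_(i < \dim V) u 0 i *: (orthonormal_basis V)`_i.
Proof. by rewrite mulmx_sum_row; apply: eq_bigr => i _; rewrite rowK. Qed.

Lemma mul_basis_mx_mem V (u : 'rV[R]_(\dim V)) : u *m basis_mx V \in V.
Proof.
rewrite mul_basis_mx; apply: memv_suml => i _; apply: memvZ.
have [b _] := orthonormal_basisP V.
by apply: (basis_mem b); rewrite mem_nth // size_tuple.
Qed.

Lemma mem_basis_mx V (v : 'rV[R]_n) :
  v \in V -> exists c : 'rV[R]_(\dim V), v = c *m basis_mx V.
Proof.
move=> vV; have [b _] := orthonormal_basisP V.
exists (\row_i coord (orthonormal_basis V) i v).
rewrite mul_basis_mx [LHS](coord_basis b vV).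
by apply: eq_bigr => i _; rewrite mxE.
Qed.

Lemma basis_mx_orthonormal V : basis_mx V *m (basis_mx V)^T = 1%:M.
Proof.
have [_ o] := orthonormal_basisP V.
apply/matrixP => i j; rewrite !mxE.
have <- : dot (orthonormal_basis V)`_i (orthonormal_basis V)`_j = (i == j)%:R.
  by rewrite o ?size_tuple.
by apply: eq_bigr => k _; rewrite !mxE.
Qed.

Lemma basis_mx_orth_compl V : basis_mx V *m (basis_mx (orth_compl V))^T = 0.
Proof.
apply/matrixP => i j; rewrite [RHS]mxE.
have rowE U (k : 'I_(\dim U)) : row k (basis_mx U) \in U.
  by rewrite rowE mul_basis_mx_mem.
have [/(_ (rowE (orth_compl V) j)) h _] := orth_complP V (row j (basis_mx (orth_compl V))).
have := h _ (rowE V i); rewrite dotC => <-.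
by rewrite mxE /dot; apply: eq_bigr => k _; rewrite !mxE.
Qed.

Lemma col_basis_mx_orthonormal V (Q := col_mx (basis_mx V) (basis_mx (orth_compl V))) :
  Q *m Q^T = 1%:M.
Proof.
rewrite /Q tr_col_mx mul_col_row !basis_mx_orthonormal basis_mx_orth_compl.
rewrite -[X in block_mx _ _ X _]trmxK trmx_mul trmxK basis_mx_orth_compl trmx0.
by rewrite -scalar_mx_block.
Qed.

(** The stacked rows are orthonormal, hence independent, in R^n. Conversely, a vector minus its
    projection to [V] lies in the complement, so the two subspaces span. *)
Lemma dim_orth_compl V : (\dim V + \dim (orth_compl V))%N = n.
Proof.
apply/eqP; rewrite eqn_leq; apply/andP; split.
  have /row_freeP/eqP : exists B, col_mx (basis_mx V) (basis_mx (orth_compl V)) *m B = 1%:M.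
    by exists (col_mx (basis_mx V) (basis_mx (orth_compl V)))^T; exact: col_basis_mx_orthonormal.
  by move=> <-; exact: rank_leq_col.
have full : (V + orth_compl V)%VS = fullv.
  apply/vspaceP => v; rewrite memvf; apply/memv_addP.
  exists (v *m (basis_mx V)^T *m basis_mx V); first exact: mul_basis_mx_mem.
  exists (v - v *m (basis_mx V)^T *m basis_mx V); last by rewrite addrC subrK.
  apply/orth_complP => u /mem_basis_mx [c ->].
  rewrite dotDl dotNl !dotE trmx_mul !mulmxA.
  by rewrite -(mulmxA (v *m _)) basis_mx_orthonormal mulmx1 subrr.
have := dimv_add_leqif V (orth_compl V) => -[+ _].
by rewrite full dimvf dim_matrix mul1r.
Qed.

Lemma dot_mul_orthonormal m (Q : 'M[R]_(m, n)) (u v : 'rV[R]_m) :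
  Q *m Q^T = 1%:M -> dot (u *m Q) (v *m Q) = dot u v.
Proof. by move=> QQ; rewrite !dotE trmx_mul mulmxA -(mulmxA u) QQ mulmx1. Qed.

End basis_matrix.

Lemma dot_row_mx (R : realType) p q (u : 'rV[R]_p) (v : 'rV[R]_q) :
  dot (row_mx u v) (row_mx u v) = dot u u + dot v v.
Proof. by rewrite !dotE tr_row_mx mul_row_col mxE. Qed.

Lemma measurable_fun_basis_mx (R : realType) n (V : {vspace 'rV[R]_n}) :
  measurable_fun setT (fun z : 'rV[R]_(\dim V) * 'rV[R]_(\dim (orth_compl V)) =>
    z.1 *m basis_mx V + z.2 *m basis_mx (orth_compl V)).
Proof. by apply: measurable_rVD; exact: measurable_rVM. Qed.

(** * Integration over the fibres of the orthogonal projection *)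

Section fibre_bound.
Context (R : realType) (n : nat) (V : {vspace 'rV[R]_n}).
Notation bl n := (@borel_lebesgue R n).
Notation E := (basis_mx V).
Notation E' := (basis_mx (orth_compl V)).

(** The factor from [g] is constant on a fibre, so the fibre integral of [h] is at most that factor
    times [C]. As [g] may fail to be measurable, [C] is pulled out of the integral of the Borel
    function [F] instead, after division by [C]. *)
Lemma le_integral_fibres (h q : 'rV[R]_n -> R) (g : 'rV[R]_n -> \bar R) (C : R) :
  measurable_fun setT h -> (forall x, 0 <= h x) ->
  measurable_fun setT q -> (forall x, 0 <= q x) ->
  (forall x, 0 <= g x)%E -> 0 <= C ->
  (forall u v, (h (u *m E + v *m E'))%:E <= g (u *m E)%R * (q (u *m E + v *m E')%R)%:E)%E ->
  (forall u : 'rV_(\dim V), \int[bl (\dim (orth_compl V))]_v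
     (q (u *m E + (v : 'rV_(\dim (orth_compl V))) *m E')%R)%:E <= C%:E)%E ->
  (\int[bl n]_x (h x)%:E <= affine_integral 0%R V g * C%:E)%E.
Proof.
move=> mh h0 mq q0 g0 C0 hgq qC.
rewrite (@tonelli_orthogonal _ _ _ _ E E' (fun x => (h x)%:E)); first last.
- by move=> x; rewrite lee_fin.
- exact/measurable_EFinP.
- exact: col_basis_mx_orthonormal.
- exact: dim_orth_compl.
pose F (u : 'rV[R]_(\dim V)) : \bar R :=
  (\int[bl (\dim (orth_compl V))]_v (h (u *m E + v *m E')%R)%:E)%E.
have mF : measurable_fun setT F.
  apply: (@measurable_fun_fubini_tonelli_F _ _ _ _ _ (bl (\dim (orth_compl V)))
    (fun z => (h (z.1 *m E + z.2 *m E'))%:E)).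
    apply/measurable_EFinP; apply: (measurableT_comp mh).
    exact: measurable_fun_basis_mx.
  by move=> z; rewrite lee_fin.
have F0 u : (0 <= F u)%E by apply: integral_ge0 => v _; rewrite lee_fin.
have FgC u : (F u <= g (u *m E) * C%:E)%E.
  apply: le_trans (lee_wpmul2l (g0 _) (qC u)).
  rewrite -ge0_integralZl //; last 2 first.
  - apply/measurable_EFinP; apply: (measurableT_comp mq).
    by apply: measurable_rVD => //; exact: measurable_rVM.
  - by move=> v _; rewrite lee_fin.
  by apply: le_integral_lower => // v; rewrite lee_fin.
(* For [C = 0] there is no division: [F] vanishes, and the right side is 0 even if the integral of
   [g] is infinite. *)
rewrite -/F; have [C_eq0|C_neq0] := eqVneq C 0.
  rewrite C_eq0 mule0 integral0_eq // => u _; apply/eqP; rewrite eq_le F0 andbT.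
  by have := FgC u; rewrite C_eq0 mule0.
have C_gt0 : 0 < C by rewrite lt_neqAle eq_sym C_neq0.
rewrite (eq_integral (fun u => C%:E * (C^-1%:E * F u))%E) => [|u _]; last first.
  by rewrite muleA -EFinM mulfV // mul1e.
have mCF : measurable_fun setT (fun u => C^-1%:E * F u)%E by exact: measurable_funeM.
have CF0 u : (0 <= C^-1%:E * F u)%E by rewrite mule_ge0 // lee_fin invr_ge0.
rewrite ge0_integralZl ?lee_fin // muleC; apply: lee_wpmul2r; first by rewrite lee_fin.
rewrite -integral_completed // /affine_integral.
apply: le_integral_lower => // u.
by rewrite lee_pdivrMl // muleC add0r -mul_basis_mx.
Qed.

End fibre_bound.

(** * Pointwise bounds on a fibre and the integral inequality *)

Lemma le_projection_fun (R : realType) n (V : {vspace 'rV[R]_n}) (f : 'rV[R]_n -> R) x w a :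
  0 <= a -> a <= f (x + w) -> w \in orth_compl V -> (a%:E <= projection_fun V f x)%E.
Proof.
move=> a0 af wV; apply: (@le_trans _ _ (f (x + w))%:E); first by rewrite lee_fin.
by apply: ereal_sup_ubound; exists (x + w) => //=; rewrite addrC addKr.
Qed.

(** As the exponents sum to 1, [a] is the product of its two powers; replacing [a] by [p] in the
    first can only increase it. *)
Lemma le_poweR_split (R : realType) (a t : R) (p : \bar R) :
  0 <= a -> (a%:E <= p)%E -> 0 <= t <= 1 ->
  (a%:E <= p `^ (1 - t) * (a `^ t)%:E)%E.
Proof.
move=> a0 ap /andP[t0 t1].
have aE : a = a `^ (1 - t) * a `^ t by rewrite -powRD ?subrK ?oner_eq0 // powRr1.
rewrite [in leLHS]aE EFinM.
apply: lee_wpmul2r; first by rewrite lee_fin powR_ge0.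
rewrite -poweR_EFin; apply: gt0_ler_poweR => //.
- by rewrite subr_ge0.
- by rewrite in_itv /= lee_fin a0 leey.
- by rewrite in_itv /= leey andbT (le_trans _ ap) ?lee_fin.
Qed.

Theorem theorem1p4 (R : realType) (n i : nat) (f : 'rV[R]_n -> R)
    (H : {vspace 'rV[R]_n}) (lambda : R)
    (hf : integrable_log_concave f) (hH : \dim H = i)
    (hlambda : 0 <= lambda <= 1) :
  (\int[lebesgue_rV R n]_z (f z)%:E <=
   affine_integral 0%R H (fun x => projection_fun H f x `^ (1 - lambda)%R) *
   ereal_sup [set affine_integral x0 (orth_compl H) (fun y => (f y `^ lambda)%:E)
             | x0 in [set x0 | x0 \in H]])%E.
Proof.
have [f0 _ _] := hf; have /andP[l0 l1] := hlambda.
set A := affine_integral _ _ _; set B := ereal_sup _.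
have A0 : (0 <= A)%E by apply: integral_ge0 => u _; exact: poweR_ge0.
have leB x0 : x0 \in H ->
    (affine_integral x0 (orth_compl H) (fun y => (f y `^ lambda)%:E) <= B)%E.
  by move=> x0H; apply: ereal_sup_ubound; exists x0.
have B0 : (0 <= B)%E.
  apply: le_trans (leB 0 (mem0v _)).
  by apply: integral_ge0 => u _; rewrite lee_fin powR_ge0.
(* From here on a bounded Borel function [h] below [f] replaces it; the bound [M] serves the case of
   infinite [B]. *)
apply: le_completed_integral => [x|h mh h0 [M hM] hf']; first by rewrite lee_fin.
have {}hf' x : h x <= f x by have := hf' x; rewrite lee_fin.
have hP x u v : x = u *m basis_mx H + v *m basis_mx (orth_compl H) ->
    forall a, 0 <= a -> a <= h x ->
    (a%:E <= projection_fun H f (u *m basis_mx H)%R `^ (1 - lambda)%R * (a `^ lambda)%:E)%E.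
  move=> xE a a0 ah; apply: le_poweR_split => //.
  apply: (le_projection_fun a0 _ (mul_basis_mx_mem v)).
  by rewrite -xE (le_trans ah).
have mpow (q : 'rV[R]_n -> R) : measurable_fun setT q ->
    measurable_fun setT (fun x => q x `^ lambda).
  by move=> mq; apply: (measurableT_comp (measurable_powR lambda) mq).
have [Boo|Bfin] := eqVneq B +oo%E; last first.
  have fB : B \is a fin_num by rewrite ge0_fin_numE // lt_neqAle Bfin leey.
  rewrite -(fineK fB).
  apply: (@le_integral_fibres _ _ H h (fun x => h x `^ lambda)) => //.
  - exact: mpow.
  - by move=> x; exact: powR_ge0.
  - by move=> x; exact: poweR_ge0.
  - exact: fine_ge0.
  - by move=> u v; exact: hP.
  move=> u; rewrite (fineK fB).
  apply: le_trans (leB _ (mul_basis_mx_mem u)).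
  (* The power of [h] is Borel on the fibre, so its integral passes to the completed measure, where
     monotonicity compares it with that of [f]. *)
  rewrite -integral_completed; first last.
  - by move=> v; rewrite lee_fin powR_ge0.
  - apply/measurable_EFinP; apply: (measurableT_comp (measurable_powR lambda)); apply: (measurableT_comp mh).
    by apply: measurable_rVD => //; exact: measurable_rVM.
  apply: le_integral_lower => v; first by rewrite lee_fin powR_ge0.
  rewrite lee_fin.
  rewrite -mul_basis_mx; by apply: ge0_ler_powR; rewrite ?nnegrE.
have [A_eq0|A_neq0] := eqVneq A 0%E; last first.
  by rewrite Boo gt0_muley ?leey // lt_neqAle eq_sym A_neq0.
rewrite A_eq0 mul0e.
(* The right-hand side is now [0 * +oo = 0]; truncating [h] to balls makes the
   fibre integrals finite. *)
have hball k : (\int[@borel_lebesgue R n]_(x in dball n (k.+1%:R : R)) (h x)%:E = 0)%E.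
  set D := dball n (k.+1%:R : R); have mD : measurable D by exact: measurable_dball.
  have mD1 : measurable_fun setT (\1_D : 'rV[R]_n -> R) by exact: measurable_indic.
  have D1_ge0 x : 0 <= \1_D x :> R by rewrite indicE.
  rewrite integral_mkcond (eq_integral (fun x => (h x * \1_D x)%:E)); last first.
    by move=> x _; rewrite patchE indicE; case: (x \in D); rewrite ?mulr1 ?mulr0.
  apply/eqP; rewrite eq_le integral_ge0 ?andbT => [|x _]; last by rewrite lee_fin mulr_ge0.
  (* The first factor bounds the power of [h]; the second is the volume of a cube of half-side k+1
     containing every slice of [D] in coordinates. *)
  pose C := M `^ lambda * (k.+1%:R *+ 2) ^+ \dim (orth_compl H).
  rewrite -[leRHS](mul0e C%:E) -A_eq0.
  apply: (@le_integral_fibres _ _ H _ (fun x => M `^ lambda * \1_D x)).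
  - exact: measurable_funM.
  - by move=> x; rewrite mulr_ge0.
  - exact: measurable_funM.
  - by move=> x; rewrite mulr_ge0 ?powR_ge0.
  - by move=> x; exact: poweR_ge0.
  - by rewrite mulr_ge0 ?powR_ge0 ?exprn_ge0 ?mulrn_wge0.
  - move=> u v; rewrite indicE; case: (_ \in D); last by rewrite !mulr0 mule0.
    rewrite !mulr1; apply: le_trans (hP _ u v erefl _ (h0 _) (lexx _)) _.
    apply: lee_wpmul2l; first exact: poweR_ge0.
    have hx := h0 (u *m basis_mx H + v *m basis_mx (orth_compl H)).
    by rewrite lee_fin ge0_ler_powR ?nnegrE // (le_trans hx).
  move=> u; pose b := box (\dim (orth_compl H)) (k.+1%:R : R).
  apply: (@le_trans _ _ (\int[@borel_lebesgue R _]_v ((M `^ lambda)%:E * (\1_b v)%:E))%E).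
    apply: le_integral_lower => v; first by rewrite lee_fin mulr_ge0 ?powR_ge0.
    rewrite -EFinM lee_fin ler_wpM2l ?powR_ge0 // !indicE.
    case: (boolP (_ \in D)) => //; rewrite inE /D /dball /= => uvD.
    (* By Pythagoras [v] is no longer than the point of [D]; the index k+1 is at least 1, as the
       passage from ball to box demands. *)
    rewrite mem_set // /b; apply: dball_sub_box; first by rewrite ler1n.
    rewrite /dball /=; apply: le_trans uvD; rewrite -mul_row_col.
    rewrite (dot_mul_orthonormal _ _ (col_basis_mx_orthonormal H)) dot_row_mx.
    by rewrite lerDr dot_ge0.
  rewrite ge0_integralZl ?lee_fin ?powR_ge0 //; last first.
    by apply/measurable_EFinP; apply: measurable_indic; exact: measurable_box.
  rewrite integral_indic ?setIT //; last exact: measurable_box.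
  rewrite EFinM lee_wpmul2l ?lee_fin ?powR_ge0 //.
  by rewrite le_eqVlt; apply/orP; left; apply/eqP; exact: borel_lebesgue_box.
(* The balls exhaust the space, since [dot x x] is below its truncation plus 1; monotone convergence
   then gives a zero integral over the whole space. *)
have cover : \bigcup_k dball n (k.+1%:R : R) = setT.
  rewrite -subTset => x _; exists (Num.truncn (dot x x)) => //=.
  exact/ltW/truncnS_gt.
have cv : (\int[@borel_lebesgue R n]_(x in dball n (k.+1%:R : R)) (h x)%:E @[k --> \oo]
    --> \int[@borel_lebesgue R n]_(x in \bigcup_k dball n (k.+1%:R : R)) (h x)%:E)%E.
  apply: ge0_nondecreasing_set_cvg_integral.
  - by move=> k l kl; apply/subsetPset => x /= /le_trans; apply; rewrite ler_nat.
  - by move=> k; exact: measurable_dball.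
  - by move=> k; apply: measurable_funTS; apply/measurable_EFinP.
  - by move=> k x _; rewrite lee_fin.
rewrite cover (_ : (fun k => _) = cst 0%E) in cv; last by apply/funext => k; exact: hball.
by rewrite [leLHS](cvg_unique _ cv (cvg_cst _)).
Qed.
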